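(* Let $(F_4)^w=\{\alpha\in F_4\mid w\alpha=\alpha w\}$. Then there is an isomorphism of groups $$(F_4)^w\cong(SU(3)\times SU(3))/\mathbb Z_3,\qquad\mathbb Z_3=\{(E,E),(\omega_1E,\omega_1E),(\omega_1^2E,\omega_1^2E)\},\quad\omega_1=-\tfrac12+\tfrac{\sqrt3}2e_1.$$
   Context: $\mathbb H$ is the field of quaternions with basis $1,e_1,e_2,e_3$ ($e_1e_2=e_3$, etc.); the Cayley algebra is $\mathfrak C=\mathbb H\oplus\mathbb He_4$ with $(m+ae_4)(n+be_4)=(mn-\overline b a)+(a\overline n+bm)e_4$ and $\overline{m+ae_4}=\overline m-ae_4$. $\mathfrak J=\{X\in M(3,\mathfrak C)\mid X^*=X\}$ with $X\circ Y=\frac12(XY+YX)$. $F_4$ is the group of $\mathbb R$-linear isomorphisms $\alpha$ of $\mathfrak J$ with $\alpha(X\circ Y)=\alpha X\circ\alpha Y$. Let $\mathbf C=\mathbb R+\mathbb Re_1\subset\mathfrak C$ (a copy of the complex numbers with imaginary unit $e_1$) and $e_6=-e_2e_4$; every $x\in\mathfrak C$ is uniquely $x=a+m_1e_2+m_2e_4+m_3e_6$ with $a,m_i\in\mathbf C$, and $w:\mathfrak C\to\mathfrak C$, $w(a+m_1e_2+m_2e_4+m_3e_6)=a+(\omega_1m_1)e_2+(\omega_1m_2)e_4+(\omega_1m_3)e_6$, is an automorphism of $\mathfrak C$ of order 3. It acts on $\mathfrak J$ entrywise, giving $w\in F_4$. $SU(3)=\{A\in M(3,\mathbf C)\mid A^*A=E,\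 \det A=1\}$, $E$ the unit matrix. *)

(* Defs.v *)
From HB Require Import structures.
From mathcomp Require Import all_boot all_order all_algebra.
From mathcomp Require Import generic_quotient ring lra complex.
From mathcomp Require Import boolp reals.

Set Implicit Arguments.
Unset Strict Implicit.
Unset Printing Implicit Defensive.

Import Order.TTheory GRing.Theory Num.Theory.

Local Open Scope quotient_scope.
Local Open Scope ring_scope.
Local Open Scope complex_scope.

Section QuotientGroup.

Record normalSubgroup (G : groupType) := NormalSubgroup {
  nsg_pred :> pred G;
  nsg_closed : group_closed nsg_pred;
  nsg_conj : forall x y : G, nsg_pred x -> nsg_pred (x ^ y)%g
}.

Variables (G : groupType) (N : normalSubgroup G).

(* x and y are equivalent iff x N = y N. *)
Definition coset_rel : rel G := fun x y => N (x^-1 * y)%g.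

Let N1 : N 1%g. Proof. exact: (nsg_closed N).1. Qed.
Let NV x : N x -> N x^-1%g.
Proof. exact: (group_closedV (nsg_closed N)). Qed.
Let NM x y : N x -> N y -> N (x * y)%g.
Proof. exact: (group_closedM (nsg_closed N)). Qed.

Lemma coset_rel_refl : reflexive coset_rel.
Proof. by move=> x; rewrite /coset_rel mulVg. Qed.

Lemma coset_rel_sym : symmetric coset_rel.
Proof.
by move=> x y; apply/idP/idP => /NV; rewrite /coset_rel invgM invgK.
Qed.

Lemma coset_rel_trans : transitive coset_rel.
Proof.
move=> y x z /NM Nxy /Nxy; rewrite /coset_rel.
by rewrite mulgA -(mulgA x^-1%g) mulgV mulg1.
Qed.

Canonical coset_equiv :=
  EquivRel coset_rel coset_rel_refl coset_rel_sym coset_rel_trans.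

Definition quot_group := {eq_quot coset_equiv}.
HB.instance Definition _ := Choice.on quot_group.
HB.instance Definition _ := EqQuotient.on quot_group.

Definition quot_one : quot_group := \pi_quot_group 1%g.
Definition quot_inv (a : quot_group) : quot_group :=
  \pi_quot_group (repr a)^-1%g.
Definition quot_mul (a b : quot_group) : quot_group :=
  \pi_quot_group (repr a * repr b)%g.

Lemma quot_eqP (x y : G) :
  reflect (\pi_quot_group x = \pi_quot_group y) (N (x^-1 * y)%g).
Proof. exact: (iffP (eqmodP coset_equiv x y)). Qed.

Lemma quot_invE (x : G) : quot_inv (\pi_quot_group x) = \pi_quot_group x^-1%g.
Proof.
apply/quot_eqP; set y := repr _.
have /quot_eqP Nxy : \pi_quot_group y = \pi_quot_group x by rewrite reprK.
have := nsg_conj y^-1%g (NV Nxy).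
by rewrite /conjg !invgM !invgK !mulgA; congr (N _); rewrite mulgK.
Qed.

Lemma quot_mulE (x y : G) :
  quot_mul (\pi_quot_group x) (\pi_quot_group y) = \pi_quot_group (x * y)%g.
Proof.
apply/quot_eqP; set x' := repr (\pi x); set y' := repr (\pi y).
have /quot_eqP Nx : \pi_quot_group x' = \pi_quot_group x by rewrite reprK.
have /quot_eqP Ny : \pi_quot_group y' = \pi_quot_group y by rewrite reprK.
have := NM (nsg_conj y' Nx) Ny.
by rewrite /conjg invgM !mulgA mulgK.
Qed.

Let quot_mulA : associative quot_mul.
Proof.
elim/(@quotW _ quot_group)=> x; elim/(@quotW _ quot_group)=> y.
elim/(@quotW _ quot_group)=> z.
by rewrite !quot_mulE mulgA.
Qed.
Let quot_mul1 : left_id quot_one quot_mul.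
Proof. by elim/(@quotW _ quot_group)=> x; rewrite quot_mulE mul1g. Qed.
Let quot_mulr1 : right_id quot_one quot_mul.
Proof. by elim/(@quotW _ quot_group)=> x; rewrite quot_mulE mulg1. Qed.
Let quot_mulV : left_inverse quot_one quot_inv quot_mul.
Proof.
by elim/(@quotW _ quot_group)=> x; rewrite quot_invE quot_mulE mulVg.
Qed.
Let quot_mulrV : right_inverse quot_one quot_inv quot_mul.
Proof.
by elim/(@quotW _ quot_group)=> x; rewrite quot_invE quot_mulE mulgV.
Qed.

HB.instance Definition _ := isGroup.Build quot_group
  quot_mulA quot_mul1 quot_mulr1 quot_mulV quot_mulrV.

End QuotientGroup.

(* Quat a b c d = a + b e1 + c e2 + d e3, with e1 e2 = e3, e2 e3 = e1 and     *)
(* e3 e1 = e2.                                                                *)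
Record quat (R : Type) := Quat { q0 : R; q1 : R; q2 : R; q3 : R }.

(* Cayley m a = m + a e4. *)
Record cayley (R : Type) := Cayley { cayl : quat R; cayr : quat R }.

Section QuatChoice.
Variable R : Type.
Definition quat_tuple (x : quat R) := (q0 x, q1 x, q2 x, q3 x).
Definition tuple_quat (t : R * R * R * R) :=
  let: (a, b, c, d) := t in Quat a b c d.
Lemma quat_tupleK : cancel quat_tuple tuple_quat. Proof. by case. Qed.
Definition cayley_pair (x : cayley R) := (cayl x, cayr x).
Definition pair_cayley (t : quat R * quat R) := Cayley t.1 t.2.
Lemma cayley_pairK : cancel cayley_pair pair_cayley. Proof. by case. Qed.
End QuatChoice.

HB.instance Definition _ (R : choiceType) :=
  Choice.copy (quat R) (can_type (@quat_tupleK R)).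
HB.instance Definition _ (R : choiceType) :=
  Choice.copy (cayley R) (can_type (@cayley_pairK R)).

Section Quaternions.
Variable R : realType.
Implicit Types x y z : quat R.

Definition quat_opp x := Quat (- q0 x) (- q1 x) (- q2 x) (- q3 x).
Definition quat_add x y :=
  Quat (q0 x + q0 y) (q1 x + q1 y) (q2 x + q2 y) (q3 x + q3 y).
Definition quat_scale (k : R) x :=
  Quat (k * q0 x) (k * q1 x) (k * q2 x) (k * q3 x).
Definition quat_mul x y := Quat
  (q0 x * q0 y - q1 x * q1 y - q2 x * q2 y - q3 x * q3 y)
  (q0 x * q1 y + q1 x * q0 y + q2 x * q3 y - q3 x * q2 y)
  (q0 x * q2 y - q1 x * q3 y + q2 x * q0 y + q3 x * q1 y)
  (q0 x * q3 y + q1 x * q2 y - q2 x * q1 y + q3 x * q0 y).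
Definition quat_conj x := Quat (q0 x) (- q1 x) (- q2 x) (- q3 x).

Ltac quat_ring :=
  repeat (let x := fresh in move=> x);
  repeat match goal with x : quat _ |- _ => case: x => ? ? ? ? end;
  rewrite /= /quat_add /quat_opp /quat_mul /quat_scale /quat_conj /=;
  congr Quat; ring.

Let quat_addA : associative quat_add. Proof. quat_ring. Qed.
Let quat_addC : commutative quat_add. Proof. quat_ring. Qed.
Let quat_add0 : left_id (Quat 0 0 0 0) quat_add. Proof. quat_ring. Qed.
Let quat_addN : left_inverse (Quat 0 0 0 0) quat_opp quat_add.
Proof. quat_ring. Qed.
HB.instance Definition _ := GRing.isZmodule.Build (quat R)
  quat_addA quat_addC quat_add0 quat_addN.

Let quat_mulA : associative quat_mul. Proof. quat_ring. Qed.
Let quat_mul1 : left_id (Quat 1 0 0 0) quat_mul. Proof. quat_ring. Qed.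
Let quat_mulr1 : right_id (Quat 1 0 0 0) quat_mul. Proof. quat_ring. Qed.
Let quat_mulDl : left_distributive quat_mul quat_add. Proof. quat_ring. Qed.
Let quat_mulDr : right_distributive quat_mul quat_add. Proof. quat_ring. Qed.
Let quat_1neq0 : Quat 1 0 0 0 != 0 :> quat R.
Proof. by apply/eqP => -[/eqP]; rewrite oner_eq0. Qed.
HB.instance Definition _ := GRing.Zmodule_isNzRing.Build (quat R)
  quat_mulA quat_mul1 quat_mulr1 quat_mulDl quat_mulDr quat_1neq0.

Let quat_scaleA a b x : quat_scale a (quat_scale b x) = quat_scale (a * b) x.
Proof. quat_ring. Qed.
Let quat_scale1 : left_id 1 quat_scale. Proof. quat_ring. Qed.
Let quat_scaleDr : right_distributive quat_scale quat_add.
Proof. quat_ring. Qed.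
Let quat_scaleDl x a b :
  quat_scale (a + b) x = quat_add (quat_scale a x) (quat_scale b x).
Proof. quat_ring. Qed.
HB.instance Definition _ := GRing.Zmodule_isLmodule.Build R (quat R)
  quat_scaleA quat_scale1 quat_scaleDr quat_scaleDl.

End Quaternions.

Section CayleyAlgebra.
Variable R : realType.
Local Notation C := (cayley R).
Implicit Types x y z : C.

Definition cayley_opp x := Cayley (- cayl x) (- cayr x).
Definition cayley_add x y := Cayley (cayl x + cayl y) (cayr x + cayr y).
Definition cayley_scale (k : R) x := Cayley (k *: cayl x) (k *: cayr x).

Definition cmul x y : C :=
  let: Cayley m a := x in let: Cayley n b := y in
  Cayley (m * n - quat_conj b * a) (a * quat_conj n + b * m).
Definition cconj x : C := Cayley (quat_conj (cayl x)) (- cayr x).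

Ltac cayley_group :=
  repeat (let x := fresh in move=> x);
  repeat match goal with x : cayley _ |- _ => case: x => ? ? end;
  rewrite /= /cayley_add /cayley_opp /cayley_scale /=;
  congr Cayley.

Let cayley_addA : associative cayley_add.
Proof. by cayley_group; rewrite addrA. Qed.
Let cayley_addC : commutative cayley_add.
Proof. by cayley_group; rewrite addrC. Qed.
Let cayley_add0 : left_id (Cayley 0 0) cayley_add.
Proof. by cayley_group; rewrite add0r. Qed.
Let cayley_addN : left_inverse (Cayley 0 0) cayley_opp cayley_add.
Proof. by cayley_group; rewrite addNr. Qed.
HB.instance Definition _ := GRing.isZmodule.Build (cayley R)
  cayley_addA cayley_addC cayley_add0 cayley_addN.

Let cayley_scaleA a b x :
  cayley_scale a (cayley_scale b x) = cayley_scale (a * b) x.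
Proof. by cayley_group; rewrite scalerA. Qed.
Let cayley_scale1 : left_id 1 cayley_scale.
Proof. by cayley_group; rewrite scale1r. Qed.
Let cayley_scaleDr : right_distributive cayley_scale cayley_add.
Proof. by cayley_group; rewrite scalerDr. Qed.
Let cayley_scaleDl x a b :
  cayley_scale (a + b) x = cayley_add (cayley_scale a x) (cayley_scale b x).
Proof. by cayley_group; rewrite scalerDl. Qed.
HB.instance Definition _ := GRing.Zmodule_isLmodule.Build R (cayley R)
  cayley_scaleA cayley_scale1 cayley_scaleDr cayley_scaleDl.

Definition ce2 : C := Cayley (Quat 0 0 1 0) 0.
Definition ce4 : C := Cayley 0 1.
Definition ce6 : C := - cmul ce2 ce4.

(* The copy R + R e1 of the complex numbers inside the Cayley algebra. *)
Definition ofC (z : R[i]) : C :=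
  Cayley (Quat (complex.Re z) (complex.Im z) 0 0) 0.

(* The components of x = a + m1 e2 + m2 e4 + m3 e6 with a, m1, m2, m3 in      *)
(* R + R e1; see cayley_decomp and cayley_decomp_inj. The formulas come from  *)
(* e1 e2 = e3, e6 = - e2 e4 and e1 e6 = e3 e4.                                *)
Definition ccomp0 x : R[i] := q0 (cayl x) +i* q1 (cayl x).
Definition ccomp1 x : R[i] := q2 (cayl x) +i* q3 (cayl x).
Definition ccomp2 x : R[i] := q0 (cayr x) +i* q1 (cayr x).
Definition ccomp3 x : R[i] := (- q2 (cayr x)) +i* q3 (cayr x).

Definition cayley_of_comp (a m1 m2 m3 : R[i]) : C :=
  ofC a + cmul (ofC m1) ce2 + cmul (ofC m2) ce4 + cmul (ofC m3) ce6.

Lemma cayley_ext x y :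
  [/\ q0 (cayl x) = q0 (cayl y), q1 (cayl x) = q1 (cayl y),
      q2 (cayl x) = q2 (cayl y) & q3 (cayl x) = q3 (cayl y)] ->
  [/\ q0 (cayr x) = q0 (cayr y), q1 (cayr x) = q1 (cayr y),
      q2 (cayr x) = q2 (cayr y) & q3 (cayr x) = q3 (cayr y)] -> x = y.
Proof.
by case: x y => [[? ? ? ?] [? ? ? ?]] [[? ? ? ?] [? ? ? ?]] /=
  [-> -> -> ->] [-> -> -> ->].
Qed.

Lemma ofC_mul (z t : R[i]) : cmul (ofC z) (ofC t) = ofC (z * t).
Proof. by case: z t => [? ?] [? ?]; apply: cayley_ext; split=> /=; ring. Qed.

Lemma ofC_conj (z : R[i]) : cconj (ofC z) = ofC z^*.
Proof. by case: z => [? ?]; apply: cayley_ext; split=> /=; ring. Qed.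

Lemma cayley_of_compE a m1 m2 m3 : cayley_of_comp a m1 m2 m3 =
  Cayley (Quat (complex.Re a) (complex.Im a) (complex.Re m1) (complex.Im m1))
    (Quat (complex.Re m2) (complex.Im m2) (- complex.Re m3) (complex.Im m3)).
Proof. by apply: cayley_ext => /=; split; ring. Qed.

Lemma cayley_decomp x :
  x = cayley_of_comp (ccomp0 x) (ccomp1 x) (ccomp2 x) (ccomp3 x).
Proof.
by rewrite cayley_of_compE /= opprK; case: x => [[? ? ? ?] [? ? ? ?]].
Qed.

Lemma cayley_decomp_inj a m1 m2 m3 b n1 n2 n3 :
  cayley_of_comp a m1 m2 m3 = cayley_of_comp b n1 n2 n3 ->
  [/\ a = b, m1 = n1, m2 = n2 & m3 = n3].
Proof.
rewrite !cayley_of_compE; case: a m1 m2 m3 b n1 n2 n3.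
move=> ? ? [? ?] [? ?] [? ?] [? ?] [? ?] [? ?] [? ?] /=.
by move=> [-> -> -> -> -> -> /oppr_inj -> ->].
Qed.

Definition omega1 : R[i] := (- (1 / 2)) +i* (Num.sqrt 3 / 2).

Definition cw x : C :=
  cayley_of_comp (ccomp0 x) (omega1 * ccomp1 x) (omega1 * ccomp2 x)
                 (omega1 * ccomp3 x).

Lemma omega1_conj : omega1^* * omega1 = 1.
Proof.
have h : Num.sqrt 3 ^+ 2 = 3 :> R by rewrite sqr_sqrtr.
by apply/eqP; rewrite eq_complex /=; apply/andP; split; apply/eqP; field: h.
Qed.

Lemma omega1_3 : omega1 ^+ 3 = 1.
Proof.
have h : Num.sqrt 3 ^+ 2 = 3 :> R by rewrite sqr_sqrtr.
apply/eqP; rewrite !exprS expr0 mulr1 eq_complex /=; apply/andP.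
by split; apply/eqP; field: h.
Qed.

Ltac cayley_ring := apply: cayley_ext; split=> /=; ring.

Lemma cconjK : involutive cconj.
Proof. by move=> [[? ? ? ?] [? ? ? ?]]; cayley_ring. Qed.

Lemma cconjD : {morph cconj : x y / x + y}.
Proof. by move=> [[? ? ? ?] [? ? ? ?]] [[? ? ? ?] [? ? ? ?]]; cayley_ring. Qed.

Lemma cconjZ k x : cconj (k *: x) = k *: cconj x.
Proof. by case: x => [[? ? ? ?] [? ? ? ?]]; cayley_ring. Qed.

Lemma cconjM x y : cconj (cmul x y) = cmul (cconj y) (cconj x).
Proof.
by case: x y => [[? ? ? ?] [? ? ? ?]] [[? ? ? ?] [? ? ? ?]]; cayley_ring.
Qed.

Lemma cwE x : cw x =
  let s := Num.sqrt 3 / 2 in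
  let: Cayley (Quat x0 x1 x2 x3) (Quat y0 y1 y2 y3) := x in
  Cayley (Quat x0 x1 (- (1 / 2) * x2 - s * x3) (- (1 / 2) * x3 + s * x2))
         (Quat (- (1 / 2) * y0 - s * y1) (- (1 / 2) * y1 + s * y0)
               (- (1 / 2) * y2 + s * y3) (- (1 / 2) * y3 - s * y2)).
Proof.
rewrite /cw cayley_of_compE; case: x => [[? ? ? ?] [? ? ? ?]] /=.
by apply: cayley_ext; split=> //=; ring.
Qed.

Lemma cwD : {morph @cw : x y / x + y}.
Proof.
move=> x y; rewrite !cwE.
by case: x y => [[? ? ? ?] [? ? ? ?]] [[? ? ? ?] [? ? ? ?]]; cayley_ring.
Qed.

Lemma cwZ k x : cw (k *: x) = k *: cw x.
Proof. by rewrite !cwE; case: x => [[? ? ? ?] [? ? ? ?]]; cayley_ring. Qed.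

Lemma cw_conj x : cw (cconj x) = cconj (cw x).
Proof. by rewrite !cwE; case: x => [[? ? ? ?] [? ? ? ?]]; cayley_ring. Qed.

Lemma cwM x y : cw (cmul x y) = cmul (cw x) (cw y).
Proof.
have h : Num.sqrt 3 ^+ 2 = 3 :> R by rewrite sqr_sqrtr.
rewrite !cwE; case: x y => [[? ? ? ?] [? ? ? ?]] [[? ? ? ?] [? ? ? ?]].
by apply: cayley_ext; split=> /=; field: h.
Qed.

Lemma cwK x : cw (cw (cw x)) = x.
Proof.
have h : Num.sqrt 3 ^+ 2 = 3 :> R by rewrite sqr_sqrtr.
rewrite !cwE; case: x => [[? ? ? ?] [? ? ? ?]].
by apply: cayley_ext; split=> /=; field: h.
Qed.

End CayleyAlgebra.

Section JordanAlgebra.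
Variable R : realType.
Local Notation C := (cayley R).
Local Notation M := 'M[cayley R]_3.
Implicit Types A B : M.

(* The coefficients do not form an associative ring, so that *m does not      *)
(* apply.                                                                     *)
Definition cmulmx A B : M := \matrix_(i, j) \sum_k cmul (A i k) (B k j).
Definition cadjmx A : M := map_mx (@cconj R) A^T.

Record jordan := Jordan { jordan_mx :> M; _ : cadjmx jordan_mx == jordan_mx }.
HB.instance Definition _ := [isSub for jordan_mx].
HB.instance Definition _ := [Choice of jordan by <:].
Implicit Types X Y Z : jordan.

Lemma jordanP X : cadjmx X = X. Proof. by apply/eqP; case: X. Qed.

Lemma cadjmxE A i j : cadjmx A i j = cconj (A j i).
Proof. by rewrite !mxE. Qed.

Lemma cconj_sum I (r : seq I) (P : pred I) (F : I -> C) :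
  cconj (\sum_(i <- r | P i) F i) = \sum_(i <- r | P i) cconj (F i).
Proof.
apply: (big_morph _ (@cconjD R)).
by apply: cayley_ext; split=> /=; rewrite ?oppr0.
Qed.

Lemma cadjmxM A B : cadjmx (cmulmx A B) = cmulmx (cadjmx B) (cadjmx A).
Proof.
apply/matrixP=> i j; rewrite cadjmxE !mxE cconj_sum.
by apply: eq_bigr => k _; rewrite !cadjmxE cconjM.
Qed.

Lemma cadjmxD A B : cadjmx (A + B) = cadjmx A + cadjmx B.
Proof. by apply/matrixP=> i j; rewrite !mxE cconjD. Qed.

Lemma cadjmxZ (k : R) A :
  cadjmx (map_mx ( *:%R k) A) = map_mx ( *:%R k) (cadjmx A).
Proof. by apply/matrixP=> i j; rewrite !mxE cconjZ. Qed.

Lemma jordan_zmod_closed :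
  zmod_closed ([pred A : M | cadjmx A == A] : {pred M}).
Proof.
split=> [|A B].
  by apply/eqP/matrixP=> i j; rewrite !mxE;
     apply: cayley_ext; split=> /=; rewrite ?oppr0.
rewrite !inE => /eqP hA /eqP hB; apply/eqP.
apply: (addIr B); rewrite -{2}hB -cadjmxD !addrNK ?subrK.
by rewrite hA.
Qed.
HB.instance Definition _ :=
  GRing.SubChoice_isSubZmodule.Build M _ jordan jordan_zmod_closed.

Definition jordan_scale (k : R) X : jordan :=
  Jordan (introT eqP (etrans (cadjmxZ k X) (congr1 _ (jordanP X)))).

Let jordan_scaleA a b X :
  jordan_scale a (jordan_scale b X) = jordan_scale (a * b) X.
Proof. by apply/val_inj/matrixP=> i j; rewrite !mxE scalerA. Qed.
Let jordan_scale1 : left_id 1 jordan_scale.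
Proof. by move=> X; apply/val_inj/matrixP=> i j; rewrite !mxE scale1r. Qed.
Let jordan_scaleDr : right_distributive jordan_scale +%R.
Proof. by move=> k X Y; apply/val_inj/matrixP=> i j; rewrite !mxE scalerDr. Qed.
Let jordan_scaleDl X : {morph jordan_scale^~ X : a b / a + b}.
Proof. by move=> a b; apply/val_inj/matrixP=> i j; rewrite !mxE scalerDl. Qed.
HB.instance Definition _ := GRing.Zmodule_isLmodule.Build R jordan
  jordan_scaleA jordan_scale1 jordan_scaleDr jordan_scaleDl.

Lemma jordan_mul_subproof X Y :
  cadjmx (cmulmx X Y + cmulmx Y X) == cmulmx X Y + cmulmx Y X.
Proof. by rewrite cadjmxD !cadjmxM !jordanP addrC. Qed.

Definition jordan_mul X Y : jordan :=
  2^-1 *: Jordan (jordan_mul_subproof X Y).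

Definition is_F4 (f : jordan -> jordan) : Prop :=
  [/\ linear f, bijective f & {morph f : X Y / jordan_mul X Y}].

Record F4 := MkF4 { F4_fun :> jordan -> jordan; _ : `[< is_F4 F4_fun >] }.
HB.instance Definition _ := [isSub for F4_fun].
HB.instance Definition _ := [Choice of F4 by <:].
Implicit Types f g : F4.

Lemma F4P f : is_F4 f. Proof. by apply/asboolP; case: f. Qed.

Lemma F4_ext f g : f =1 g -> f = g.
Proof. by move=> fg; apply/val_inj/funext. Qed.

Lemma F4_one_subproof : is_F4 id.
Proof. by split=> //; exists id. Qed.

Lemma F4_mul_subproof f g : is_F4 (f \o g).
Proof.
have [lf bf mf] := F4P f; have [lg bg mg] := F4P g.
split; [|exact: bij_comp|by move=> X Y /=; rewrite mg mf].
by move=> k X Y /=; rewrite lg lf.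
Qed.

Lemma F4_inv_exists f : exists g : F4, cancel f g /\ cancel g f.
Proof.
have [lf [g fK gK] mf] := F4P f.
suff hg : is_F4 g by exists (MkF4 (introT (asboolP _) hg)).
split; [|by exists f|].
- by move=> k X Y; apply: (can_inj fK); rewrite lf !gK.
- by move=> X Y; apply: (can_inj fK); rewrite mf !gK.
Qed.

Definition F4_one : F4 := MkF4 (introT (asboolP _) F4_one_subproof).
Definition F4_mul f g : F4 := MkF4 (introT (asboolP _) (F4_mul_subproof f g)).
Definition F4_inv f : F4 := sval (cid (F4_inv_exists f)).

Lemma F4_invK f : cancel f (F4_inv f).
Proof. by rewrite /F4_inv; case: cid => g []. Qed.
Lemma F4_Kinv f : cancel (F4_inv f) f.
Proof. by rewrite /F4_inv; case: cid => g []. Qed.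

Let F4_mulA : associative F4_mul. Proof. by move=> f g h; apply: F4_ext. Qed.
Let F4_mul1 : left_id F4_one F4_mul. Proof. by move=> f; apply: F4_ext. Qed.
Let F4_mulr1 : right_id F4_one F4_mul. Proof. by move=> f; apply: F4_ext. Qed.
Let F4_mulV : left_inverse F4_one F4_inv F4_mul.
Proof. by move=> f; apply: F4_ext => X /=; rewrite F4_invK. Qed.
Let F4_mulrV : right_inverse F4_one F4_inv F4_mul.
Proof. by move=> f; apply: F4_ext => X /=; rewrite F4_Kinv. Qed.
HB.instance Definition _ :=
  isGroup.Build F4 F4_mulA F4_mul1 F4_mulr1 F4_mulV F4_mulrV.

Lemma jordan_w_subproof X :
  cadjmx (map_mx (@cw R) X) == map_mx (@cw R) X.
Proof.
apply/eqP/matrixP=> i j; rewrite !mxE -cw_conj -[in RHS](jordanP X).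
by rewrite cadjmxE.
Qed.

Definition jordan_w X : jordan := Jordan (jordan_w_subproof X).

Lemma jordan_w_F4 : is_F4 jordan_w.
Proof.
have w3 X : jordan_w (jordan_w (jordan_w X)) = X.
  by apply/val_inj/matrixP=> i j; rewrite !mxE cwK.
split; last 1 first.
- move=> X Y; apply/val_inj/matrixP=> i j; rewrite !mxE cwZ cwD.
  have cwS (F : 'I_3 -> C) : cw (\sum_k F k) = \sum_k cw (F k).
    apply: (big_morph _ (@cwD R)).
    by rewrite -[0 in LHS](scale0r 0) cwZ scale0r.
  by congr (_ *: (_ + _)); rewrite cwS; apply: eq_bigr => k _;
     rewrite !mxE cwM.
- by move=> k X Y; apply/val_inj/matrixP=> i j; rewrite !mxE cwD cwZ.
- by exists (jordan_w \o jordan_w) => X /=; rewrite w3.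
Qed.

Definition w_F4 : F4 := MkF4 (introT (asboolP _) jordan_w_F4).

Record F4w := MkF4w
  { F4w_val :> F4; _ : (w_F4 * F4w_val == F4w_val * w_F4)%g }.
HB.instance Definition _ := [isSub for F4w_val].
HB.instance Definition _ := [Choice of F4w by <:].

Lemma F4w_group_closed :
  group_closed ([pred f : F4 | (w_F4 * f == f * w_F4)%g] : {pred F4}).
Proof.
split=> [|f g]; first by rewrite inE mulg1 mul1g.
rewrite !inE => /eqP cf /eqP cg; apply/eqP.
exact: (commuteM cf (commuteV cg)).
Qed.
HB.instance Definition _ :=
  SubChoice_isSubGroup.Build F4 _ F4w F4w_group_closed.

End JordanAlgebra.

Section SpecialUnitary.
Variable R : realType.
Local Notation M := 'M[R[i]]_3.

Definition adjmx (A : M) : M := map_mx (@conjc R) A^T.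

Record SU3 := MkSU3 {
  SU3_mx :> M;
  _ : (adjmx SU3_mx *m SU3_mx == 1%:M) && (\det SU3_mx == 1)
}.
HB.instance Definition _ := [isSub for SU3_mx].
HB.instance Definition _ := [Choice of SU3 by <:].
Implicit Types A B : SU3.

Lemma SU3P A : adjmx A *m A = 1%:M /\ \det A = 1.
Proof. by case: A => A /= /andP[/eqP ? /eqP ?]. Qed.

Lemma adjmxM (A B : M) : adjmx (A *m B) = adjmx B *m adjmx A.
Proof. by rewrite /adjmx trmx_mul map_mxM. Qed.

Lemma adjmxK : involutive adjmx.
Proof. by move=> A; apply/matrixP=> i j; rewrite !mxE conjcK. Qed.

Lemma SU3_one_subproof :
  (adjmx 1%:M *m 1%:M == 1%:M) && (\det (1%:M : M) == 1).
Proof. by rewrite mulmx1 det1 /adjmx trmx1 map_mx1 !eqxx. Qed.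

Lemma SU3_mul_subproof A B :
  (adjmx (A *m B) *m (A *m B) == 1%:M) && (\det (A *m B) == 1).
Proof.
have [uA dA] := SU3P A; have [uB dB] := SU3P B.
rewrite adjmxM mulmxA -(mulmxA (adjmx B)) uA mulmx1 uB det_mulmx dA dB.
by rewrite mulr1 !eqxx.
Qed.

Lemma SU3_inv_subproof A :
  (adjmx (adjmx A) *m adjmx A == 1%:M) && (\det (adjmx A) == 1).
Proof.
have [uA dA] := SU3P A; rewrite adjmxK (mulmx1C uA) eqxx /=.
by rewrite /adjmx det_map_mx det_tr dA rmorph1.
Qed.

Definition SU3_one : SU3 := MkSU3 SU3_one_subproof.
Definition SU3_mul A B : SU3 := MkSU3 (SU3_mul_subproof A B).
Definition SU3_inv A : SU3 := MkSU3 (SU3_inv_subproof A).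

Let SU3_mulA : associative SU3_mul.
Proof. by move=> A B D; apply/val_inj; rewrite /= mulmxA. Qed.
Let SU3_mul1 : left_id SU3_one SU3_mul.
Proof. by move=> A; apply/val_inj; rewrite /= mul1mx. Qed.
Let SU3_mulr1 : right_id SU3_one SU3_mul.
Proof. by move=> A; apply/val_inj; rewrite /= mulmx1. Qed.
Let SU3_mulV : left_inverse SU3_one SU3_inv SU3_mul.
Proof. by move=> A; apply/val_inj; rewrite /= (SU3P A).1. Qed.
Let SU3_mulrV : right_inverse SU3_one SU3_inv SU3_mul.
Proof. by move=> A; apply/val_inj; rewrite /= (mulmx1C (SU3P A).1). Qed.
HB.instance Definition _ :=
  isGroup.Build SU3 SU3_mulA SU3_mul1 SU3_mulr1 SU3_mulV SU3_mulrV.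

Lemma SU3_omega_subproof :
  (adjmx (omega1 R)%:M *m (omega1 R)%:M == 1%:M) &&
  (\det ((omega1 R)%:M : M) == 1).
Proof.
rewrite det_scalar omega1_3 eqxx andbT /adjmx tr_scalar_mx map_scalar_mx.
by rewrite -scalar_mxM /= omega1_conj.
Qed.

Definition SU3_omega : SU3 := MkSU3 SU3_omega_subproof.

Definition Z3_pred : pred (SU3 * SU3) := fun p =>
  p \in [:: (1, 1); (SU3_omega, SU3_omega);
            (SU3_omega ^+ 2, SU3_omega ^+ 2)]%g.

Lemma SU3_omega3 : (SU3_omega ^+ 3 = 1)%g.
Proof.
by apply/val_inj; rewrite /= -!scalar_mxM -omega1_3 !exprS expr0 mulr1.
Qed.

Lemma SU3_omegaC A : commute A SU3_omega.
Proof. by apply/val_inj; rewrite /= scalar_mxC. Qed.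

Lemma Z3_predP p :
  reflect (exists n, p = (SU3_omega ^+ n, SU3_omega ^+ n)%g) (Z3_pred p).
Proof.
apply: (iffP idP) => [|[n ->]].
  rewrite /Z3_pred !inE => /or3P[] /eqP ->.
  - by exists 0.
  - by exists 1.
  - by exists 2.
have e n' : (SU3_omega ^+ n' = SU3_omega ^+ (n' %% 3))%g.
  by rewrite {1}(divn_eq n' 3) expgnDr mulnC expgnA SU3_omega3 expg1n mul1g.
rewrite e /Z3_pred; have : (n %% 3 < 3)%N by rewrite ltn_mod.
by case: (n %% 3)%N => [|[|[|]]] //= _; rewrite !inE ?eqxx ?orbT.
Qed.

Lemma Z3_closed : group_closed Z3_pred.
Proof.
split=> [|p q /Z3_predP[m ->] /Z3_predP[n ->]]; 
  first exact/Z3_predP/(ex_intro _ 0).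
apply/Z3_predP; exists (m + 2 * n)%N; apply/eqP; rewrite xpair_eqE.
suff -> : (SU3_omega ^+ m / SU3_omega ^+ n = SU3_omega ^+ (m + 2 * n))%g.
  by rewrite eqxx.
apply: (mulIg (SU3_omega ^+ n)%g); rewrite mulgVK -expgnDr -addnA.
by rewrite -mulSnr expgnDr expgnA SU3_omega3 expg1n mulg1.
Qed.

Lemma Z3_conj p q : Z3_pred p -> Z3_pred (p ^ q)%g.
Proof.
case: q => q1 q2 /Z3_predP[n ->]; apply/Z3_predP; exists n.
congr (_, _).
- by apply/conjg_fixP/commgP/commute_sym/commuteX/SU3_omegaC.
- by apply/conjg_fixP/commgP/commute_sym/commuteX/SU3_omegaC.
Qed.

Definition Z3 : normalSubgroup (SU3 * SU3)%type :=
  NormalSubgroup Z3_closed Z3_conj.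

End SpecialUnitary.

(* Main.v *)
Require Import Defs.
From mathcomp Require Import all_boot all_order all_algebra.
From mathcomp Require Import reals.
From HB Require Import structures.
From mathcomp Require Import ring complex boolp.

(** Write a Cayley number as a pair (a, m), with a in C and m in C^3, where
C = R + R e1. An element X of the Jordan algebra then becomes a pair (H, M):
the C-parts of its entries form a hermitian matrix H = [jpart X], and the
C^3-parts of the entries (2,3), (3,1), (1,2), which determine all the other
C^3-parts, are the columns of a complex matrix M = [mpart X]. In these
coordinates w is (H, M) |-> (H, omega1 M), and the Jordan product is given by
([jpartM], [mpartM])
<<
  2 (H, M) o (K, N) = (H K + K H + D(adj(M) N + adj(N) M),
                       N D(H) + M D(K) + conj(M x N))
>>
where D(H) = tr(H) 1 - H ([trdual]) and M x N is the polarised comatrix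
([cross]). For P and A in SU(3) the map (H, M) |-> (A H adj(A), P M adj(A))
respects these formulas, because comatrices are multiplicative and the
comatrix of an element of SU(3) is its conjugate; it commutes with w. This is
the homomorphism [act] from SU(3) x SU(3) to the centraliser of w. If (P, A)
acts trivially then P M = M A for all M, so P = A is a scalar matrix, whose
entry is a cube root of unity as its determinant is 1 ([act_ker]).

The substance is surjectivity ([act_surj]). An automorphism commuting with w
preserves the eigenspaces of w, hence has the form
(H, M) |-> (gamma H, beta M) with beta linear over C. The product of (H, 0) by
(0, M) gives beta(M D(H)) = beta(M) D(gamma H), and the square of (0, 1) shows
that U = beta(1) lies in SU(3). Put G(Z) = adj(U) beta(Z). As every hermitian
matrix is D of a hermitian matrix, beta(M Z) = beta(M) G(Z) for hermitian Z,
hence for every Z by linearity over C. Since beta(Z) = U G(Z), this says that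
G is multiplicative, and G commutes with adj because gamma preserves hermitian
matrices. By the Skolem-Noether argument
([skolem_noether_intertwiner]) and a rescaling, G(Z) = A Z adj(A) with A in
SU(3). Therefore beta(Z) = (U A) Z adj(A), and gamma H = A H adj(A) because
D(gamma H) = G(D(H)) and D is injective. The linearity of beta over C is what
rules out the automorphisms H |-> A conj(H) adj(A) of the hermitian part: they
would make G an antiautomorphism. *)

Set Implicit Arguments.
Unset Strict Implicit.
Unset Printing Implicit Defensive.

Import Order.TTheory GRing.Theory Num.Theory.

Local Open Scope ring_scope.
Local Open Scope complex_scope.

(** * Three by three matrices and the cross product *)

Lemma ord3_ind (P : 'I_3 -> Prop) : P 0 -> P 1 -> P 2 -> forall i, P i.
Proof.
move=> P0 P1 P2 [[|[|[|//]]] lt_i3].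
- by rewrite (_ : Ordinal lt_i3 = 0) //; apply/val_inj.
- by rewrite (_ : Ordinal lt_i3 = 1) //; apply/val_inj.
- by rewrite (_ : Ordinal lt_i3 = 2) //; apply/val_inj.
Qed.

Lemma sum_ord3 (V : nmodType) (F : 'I_3 -> V) :
  \sum_i F i = F 0 + F 1 + F 2.
Proof.
rewrite !big_ord_recl big_ord0 addr0 addrA.
by congr (_ + F _ + F _); apply/val_inj.
Qed.

(** Indices modulo 3 are taken relative to a variable base point [l], which
replaces case analyses on [l] in the computations below. *)
Lemma sum_ord3_rot (V : nmodType) (F : 'I_3 -> V) l :
  \sum_i F i = F l + F (l + 1) + F (l + 2).
Proof. by rewrite (reindex_inj (addrI l)) sum_ord3 addr0. Qed.

Lemma ord3_add :
  (((0 + 1)%R = 1 :> 'I_3) * ((1 + 1)%R = 2 :> 'I_3) *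
   ((2 + 1)%R = 0 :> 'I_3) * ((0 + 2)%R = 2 :> 'I_3) *
   ((1 + 2)%R = 0 :> 'I_3) * ((2 + 2)%R = 1 :> 'I_3))%type.
Proof. by do !split; apply/val_inj. Qed.

Lemma ord3_addA (l : 'I_3) :
  (((l + 1 + 1)%R = (l + 2)%R) * ((l + 1 + 2)%R = l) *
   ((l + 2 + 1)%R = l) * ((l + 2 + 2)%R = (l + 1)%R))%type.
Proof. by do !split; elim/ord3_ind: l; rewrite !ord3_add. Qed.

Section Cross.
Variable F : comPzRingType.
Implicit Types M N P Q : 'M[F]_3.

(** Each entry is a 2 x 2 minor; taking the indices cyclically absorbs the
cofactor signs. *)
Definition comatrix M : 'M[F]_3 := \matrix_(k, l)
  (M (k + 1) (l + 1) * M (k + 2) (l + 2)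
   - M (k + 1) (l + 2) * M (k + 2) (l + 1)).

(** The symmetric bilinear map attached to the quadratic map [comatrix], with
[cross M M] equal to twice the comatrix. *)
Definition cross M N : 'M[F]_3 := comatrix (M + N) - comatrix M - comatrix N.

Lemma det3 M : \det M =
  M 0 0 * (M 1 1 * M 2 2 - M 1 2 * M 2 1)
  - M 0 1 * (M 1 0 * M 2 2 - M 1 2 * M 2 0)
  + M 0 2 * (M 1 0 * M 2 1 - M 1 1 * M 2 0).
Proof.
rewrite (expand_det_row _ 0) sum_ord3 /cofactor !(expand_det_row _ ord0).
rewrite !big_ord_recl !big_ord0 /cofactor !det_mx11 !mxE.
(* Reading the entries through their numerical indices lets the indices built
   from [lift] compute. *)
have [g gE] : exists g, forall i j, M i j = g (val i) (val j).
  by exists (fun a b => M (inord a) (inord b)) => i j; rewrite !inord_val.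
by rewrite !gE /= /bump /=; ring.
Qed.

Lemma comatrixM M N : comatrix (M *m N) = comatrix M *m comatrix N.
Proof.
by apply/matrixP=> k l; rewrite !mxE !sum_ord3 !mxE !ord3_add; ring.
Qed.

Lemma comatrix1 : comatrix 1%:M = 1%:M.
Proof.
apply/matrixP=> k l; rewrite !mxE.
by elim/ord3_ind: k; elim/ord3_ind: l; rewrite !ord3_add /=; ring.
Qed.

Lemma comatrix_det M : (comatrix M)^T *m M = (\det M)%:M.
Proof.
apply/matrixP=> k l; rewrite !mxE sum_ord3 !mxE det3 !ord3_add.
by elim/ord3_ind: k; elim/ord3_ind: l; rewrite !ord3_add /=; ring.
Qed.

Lemma crossM P Q M N :
  cross (P *m M *m Q) (P *m N *m Q) =
  comatrix P *m cross M N *m comatrix Q.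
Proof.
by rewrite /cross -mulmxDl -mulmxDr !comatrixM -!mulmxBl -!mulmxBr.
Qed.

Lemma crossMM M : cross M M = comatrix M *+ 2.
Proof. by apply/matrixP=> k l; rewrite mulr2n !mxE; ring. Qed.

End Cross.

(** * The Skolem-Noether argument *)

Lemma commuting_scalar (F : pzRingType) n (N : 'M[F]_n.+1) :
  (forall M : 'M_n.+1, N *m M = M *m N) -> N = (N 0 0)%:M.
Proof.
move=> cN; apply/matrixP=> i j.
have /matrixP/(_ i 0) := cN (delta_mx j 0).
rewrite !mxE (bigD1 j) //= mxE !eqxx mulr1 big1 => [|k ne_kj]; last first.
  by rewrite mxE (negbTE ne_kj) mulr0.
rewrite addr0 => ->; rewrite (bigD1 0) //= big1 => [|k ne_k0]; last first.
  by rewrite mxE (negbTE ne_k0) andbF mul0r.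
by rewrite mxE eqxx andbT addr0 mulr_natl mulrb; case: eqP.
Qed.

(** A multiplicative linear endomorphism [G] of a matrix algebra is intertwined
with the identity by the matrix [B i] whose column [j] is the column [i] of
[G E_j0], since [Z E_j0] is the combination of the [E_k0] with coefficients
[Z k j]. The matrices [B i] cannot all vanish: otherwise every [G E_j0], hence
every [G E_jj] and [G 1], would be zero. *)
Lemma skolem_noether_intertwiner (F : fieldType) n
    (G : 'M[F]_n.+1 -> 'M[F]_n.+1) :
  linear G -> {morph G : Z W / Z *m W} -> G 1%:M = 1%:M ->
  exists2 B, B != 0 & forall Z, G Z *m B = B *m Z.
Proof.
move=> linG GM G1.
have GD : {morph G : Z W / Z + W}.
  by move=> Z W; rewrite -[Z]scale1r linG !scale1r.
have G0 : G 0 = 0.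
  by have := linG (-1) 0 0; rewrite scaler0 scaleN1r !addNr addr0.
have GZ c Z : G (c *: Z) = c *: G Z by rewrite -[c *: Z]addr0 linG G0 addr0.
pose B i : 'M_n.+1 := \matrix_(p, j) G (delta_mx j 0) p i.
have BP i Z : G Z *m B i = B i *m Z.
  apply/matrixP=> p j.
  transitivity (G (Z *m delta_mx j 0) p i).
    by rewrite GM !mxE; apply: eq_bigr => k _; rewrite mxE.
  have -> : Z *m delta_mx j 0 = \sum_k Z k j *: delta_mx k 0 :> 'M_n.+1.
    apply/matrixP=> k l; rewrite mxE summxE (bigD1 j) //= [in RHS](bigD1 k) //=.
    rewrite [in LHS]big1 => [|k' ne_k']; last first.
      by rewrite mxE (negbTE ne_k') mulr0.
    rewrite [in RHS]big1 => [|k' ne_k']; last first.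
      by rewrite !mxE eq_sym (negbTE ne_k') mulr0.
    by rewrite !mxE !eqxx.
  rewrite (big_morph G GD G0) summxE !mxE; apply: eq_bigr => k _.
  by rewrite GZ !mxE mulrC.
case: (boolP [exists i, B i != 0]) => [/existsP[i nzBi]|].
  by exists (B i).
rewrite negb_exists => /forallP B0; have /eqP[] := oner_neq0 F.
have Gj0 j : G (delta_mx j 0) = 0 :> 'M_n.+1.
  apply/matrixP=> p i; have /eqP/matrixP/(_ p j) := negbNE (B0 i).
  by rewrite !mxE.
have id_sum : 1%:M =
    \sum_j (delta_mx j 0 : 'M_n.+1) *m (delta_mx 0 j : 'M_n.+1) :> 'M[F]_n.+1.
  apply/matrixP=> p q; rewrite summxE (bigD1 p) //= mul_delta_mx !mxE eqxx.
  rewrite big1 ?addr0 1?[q == p]eq_sym // => k ne_kp.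
  by rewrite mul_delta_mx mxE eq_sym (negbTE ne_kp).
have := congr1 (fun M : 'M_n.+1 => M 0 0) G1.
rewrite id_sum (big_morph G GD G0) -id_sum big1 ?mxE => [/esym //|j _].
by rewrite GM Gj0 mul0mx.
Qed.

(** * Hermitian adjoints and special unitary matrices *)

Section HermitianAdjoint.
Variable R : realType.
Local Notation M3 := 'M[R[i]]_3.
Implicit Types A B H K M N P Z : M3.

Lemma adjmxE A i j : adjmx A i j = (A j i)^*%C.
Proof. by rewrite !mxE. Qed.

Lemma adjmxD A B : adjmx (A + B) = adjmx A + adjmx B :> M3.
Proof. by rewrite /adjmx linearD map_mxD. Qed.

Lemma adjmxZ c A : adjmx (c *: A) = c^*%C *: adjmx A.
Proof. by rewrite /adjmx linearZ map_mxZ. Qed.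

Lemma adjmx0 : adjmx (0 : M3) = 0.
Proof. by rewrite -(scale0r 0) adjmxZ conjc0 !scale0r. Qed.

Lemma adjmx1 : adjmx (1%:M : M3) = 1%:M.
Proof. by rewrite /adjmx trmx1 map_mx1. Qed.

Lemma SU3_mulV (A : SU3 R) : A *m adjmx A = 1%:M.
Proof. exact: mulmx1C (SU3P A).1. Qed.

(** The comatrix is the transpose of the adjugate, which is the inverse, that
is the adjoint, when the determinant is 1. *)
Lemma comatrix_SU3 (A : SU3 R) : comatrix A = map_mx conjc A.
Proof.
have [uA dA] := SU3P A.
have := congr1 (mulmx^~ (adjmx A)) (comatrix_det A).
rewrite -mulmxA SU3_mulV mulmx1 dA mul1mx => /(congr1 trmx).
by rewrite trmxK => ->; rewrite /adjmx -map_trmx trmxK.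
Qed.

Lemma comatrix_adj_SU3 (A : SU3 R) :
  comatrix (adjmx A) = map_mx conjc (adjmx A).
Proof. exact: (comatrix_SU3 (A^-1)%g). Qed.

Definition ccross M N : M3 := map_mx conjc (cross M N).

Lemma ccross_SU3 (P A : SU3 R) M N :
  ccross (P *m M *m adjmx A) (P *m N *m adjmx A) =
  P *m ccross M N *m adjmx A.
Proof.
have conjK (B : M3) : map_mx conjc (map_mx conjc B) = B.
  by apply/matrixP=> i j; rewrite !mxE conjcK.
by rewrite /ccross crossM comatrix_SU3 comatrix_adj_SU3 !map_mxM !conjK.
Qed.

(** Up to a factor 2, the Freudenthal product of [H] with the unit matrix. It
carries the action of the hermitian part on the other one: if antisymmetric
matrices are identified with row vectors, then S |-> H S + S H^T becomes right
multiplication by [trdual H]. *)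
Definition trdual H : M3 := (\tr H)%:M - H.

Lemma trdualD H N : trdual (H + N) = trdual H + trdual N.
Proof. by rewrite /trdual mxtraceD raddfD /= opprD addrACA. Qed.

Lemma trdual_conj (A : SU3 R) H :
  trdual (A *m H *m adjmx A) = A *m trdual H *m adjmx A.
Proof.
rewrite /trdual mxtrace_mulC mulmxA (SU3P A).1 mul1mx.
by rewrite mulmxBr mulmxBl mul_mx_scalar -scalemxAl SU3_mulV scalemx1.
Qed.

Lemma herm_decomp Z : exists H K,
  [/\ adjmx H = H, adjmx K = K & Z = H + 'i%C *: K].
Proof.
have [h hJ h2] : exists2 h : R[i], h^*%C = h & h + h = 1.
  exists 2^-1; first by rewrite conjc_inv conjc_nat.
  by rewrite -[LHS]mulr2n -[LHS]mulr_natr mulVf // pnatr_eq0.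
have [u [uJ uu ui]] : exists u : R[i], [/\ u^*%C = - u, u * u = -1 & 'i%C = u].
  exists 'i%C; split=> //; last by rewrite -expr2 sqr_i.
  by apply/eqP; rewrite eq_complex /= oppr0 !eqxx.
rewrite ui; exists (h *: (Z + adjmx Z)), ((h * - u) *: (Z - adjmx Z)); split.
- by rewrite adjmxZ hJ adjmxD adjmxK addrC.
- rewrite adjmxZ rmorphM rmorphN /= uJ hJ opprK adjmxD -scaleN1r adjmxZ adjmxK.
  by rewrite rmorphN1 !scaleN1r mulrN scaleNr -scalerN opprB.
- rewrite scalerA mulrCA mulrN uu opprK mulr1 -scalerDr addrACA subrr addr0.
  by rewrite scalerDr -scalerDl h2 scale1r.
Qed.

Lemma adjmx_mul_diag B j : (adjmx B *m B) j j = \sum_k B k j * (B k j)^*%C.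
Proof. by rewrite mxE; apply: eq_bigr => k _; rewrite adjmxE mulrC. Qed.

Lemma adjmx_mul_eq0 B : adjmx B *m B = 0 -> B = 0.
Proof.
move=> B0; apply/matrixP=> i j; rewrite mxE.
have /eqP := congr1 (fun M : M3 => M j j) B0.
rewrite adjmx_mul_diag [X in _ == X]mxE.
rewrite psumr_eq0 => [|k _]; last exact: mulcJ_ge0.
move=> /allP/(_ i (mem_index_enum i)) /=.
by rewrite mulf_eq0 conjc_eq0 orbb => /eqP.
Qed.

(** A cube root of the inverse determinant rescales [B] to determinant 1. Then
adj(A) A is a nonnegative scalar matrix of determinant 1, hence is 1. *)
Lemma similitude_SU3 B c : B != 0 -> adjmx B *m B = c%:M ->
  exists s (A : SU3 R), s *: B = A.
Proof.
move=> nzB BB.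
have detadj N : \det (adjmx N) = (\det N)^*%C.
  by rewrite /adjmx det_map_mx det_tr.
have nzc : c != 0.
  apply: contraNneq nzB => c0.
  by rewrite (adjmx_mul_eq0 (B := B)) // BB c0 raddf0.
have nzdet : \det B != 0.
  have := congr1 (fun N : M3 => \det N) BB.
  rewrite det_mulmx det_scalar => h; apply: contra_neq (expf_neq0 3 nzc) => d0.
  by rewrite -h d0 mulr0.
pose s : R[i] := 3.-root (\det B)^-1.
have s3 : s ^+ 3 = (\det B)^-1 by rewrite rootCK.
have dA : \det (s *: B) = 1 by rewrite detZ s3 mulVf.
have AA : adjmx (s *: B) *m (s *: B) = (s^*%C * (s * c))%:M.
  by rewrite adjmxZ -scalemxAl -scalemxAr BB !scale_scalar_mx.
have d3 : (s^*%C * (s * c)) ^+ 3 = 1.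
  by rewrite -det_scalar -AA det_mulmx detadj dA conjc1 mulr1.
have d1 : s^*%C * (s * c) = 1.
  apply/eqP; rewrite -(pexpr_eq1 (n := 3)) ?d3 //.
  have -> : s^*%C * (s * c) = ((s^*%C * (s * c))%:M : M3) 0 0.
    by rewrite mxE eqxx.
  by rewrite -AA adjmx_mul_diag; apply: sumr_ge0 => k _; exact: mulcJ_ge0.
have SA : (adjmx (s *: B) *m (s *: B) == 1%:M) && (\det (s *: B) == 1).
  by rewrite AA d1 dA !eqxx.
by exists s, (MkSU3 SA).
Qed.

Lemma trdualZ c H : trdual (c *: H) = c *: trdual H.
Proof. by rewrite /trdual mxtraceZ scalerBr scale_scalar_mx. Qed.

Lemma trdualB H K : trdual (H - K) = trdual H - trdual K.
Proof. by rewrite trdualD -scaleN1r trdualZ scaleN1r. Qed.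

Lemma trdual_adj H : adjmx (trdual H) = trdual (adjmx H).
Proof.
apply/matrixP=> i j; rewrite adjmxE !mxE rmorphB rmorphMn /= eq_sym.
rewrite rmorph_sum; congr (_ *+ _ - _).
by apply: eq_bigr => k _; rewrite adjmxE.
Qed.

Lemma trdual_twice H : trdual (trdual H) = (\tr H)%:M + H.
Proof.
have trD : \tr (trdual H) = \tr H *+ 2.
  by rewrite /trdual mxtraceD mxtrace_scalar raddfN /= mulrSr addrK.
rewrite {1}/trdual trD; apply/matrixP=> i j; rewrite !mxE.
by rewrite opprB addrA mulr2n mulrnDl addrAC addrK addrC.
Qed.

(** [trdual] is inverted by H |-> (trdual H - H) / 2: it is 2 on scalar matrices
and -1 on matrices of trace 0. *)
Lemma trdualK H : trdual (2^-1 *: (trdual H - H)) = H.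
Proof.
rewrite trdualZ trdualB trdual_twice /trdual opprB [_%:M + H]addrC.
rewrite addrACA subrr addr0.
by rewrite -mulr2n -[H *+ 2]scaler_nat scalerA mulVf ?scale1r // pnatr_eq0.
Qed.

Lemma trdual_linv H : 2^-1 *: (trdual (trdual H) - trdual H) = H.
Proof. by rewrite -trdualB -trdualZ trdualK. Qed.

Lemma trdual_inj : injective trdual.
Proof. by move=> H K e; rewrite -[H]trdual_linv e trdual_linv. Qed.

Lemma trdual0 : trdual (0 : M3) = 0.
Proof. by have := trdualZ 0 (0 : M3); rewrite !scale0r. Qed.

Lemma ccross0 N : ccross 0 N = 0.
Proof.
have cross0 : cross 0 N = 0 by apply/matrixP=> k l; rewrite !mxE; ring.
by rewrite /ccross cross0 map_mx0.
Qed.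

Lemma half_double N : (2^-1)%:C *: (N *+ 2) = N.
Proof.
rewrite -[N *+ 2]scaler_nat scalerA -(rmorph_nat (real_complex R)) -rmorphM.
by rewrite mulVf ?scale1r // pnatr_eq0.
Qed.

Lemma half_neq0 : (2^-1)%:C != 0 :> R[i].
Proof. by rewrite fmorph_eq0 invr_eq0 pnatr_eq0. Qed.

End HermitianAdjoint.

(** * Complex coordinates on the Cayley algebra *)

Section Coordinates.
Variable R : realType.
Implicit Types x y : cayley R.

Definition cvec x (k : 'I_3) : R[i] :=
  [:: ccomp1 x; ccomp2 x; ccomp3 x]`_k.

Lemma cayley_coord_ext x y : ccomp0 x = ccomp0 y -> cvec x =1 cvec y -> x = y.
Proof.
move=> e0 ev; rewrite [x]cayley_decomp [y]cayley_decomp e0.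
by move: (ev 0) (ev 1) (ev 2); rewrite /cvec /= => -> -> ->.
Qed.

Lemma ccomp0D x y : ccomp0 (x + y) = ccomp0 x + ccomp0 y.
Proof. by []. Qed.

Lemma cvecD x y k : cvec (x + y) k = cvec x k + cvec y k.
Proof.
elim/ord3_ind: k; rewrite /cvec //=.
by apply/eqP; rewrite eq_complex /= opprD !eqxx.
Qed.

Lemma ccomp0Z r x : ccomp0 (r *: x) = r%:C * ccomp0 x.
Proof. by apply/eqP; rewrite eq_complex /= !mul0r subr0 addr0 !eqxx. Qed.

Lemma cvecZ r x k : cvec (r *: x) k = r%:C * cvec x k.
Proof.
apply/eqP; elim/ord3_ind: k; rewrite eq_complex /=; apply/andP; split;
 apply/eqP; ring.
Qed.

Lemma ccomp0_conj x : ccomp0 (cconj x) = (ccomp0 x)^*%C.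
Proof. by []. Qed.

Lemma cvec_conj x k : cvec (cconj x) k = - cvec x k.
Proof.
by elim/ord3_ind: k; rewrite /cvec /=; apply/eqP; rewrite eq_complex /= !eqxx.
Qed.

Lemma ccomp0M x y :
  ccomp0 (cmul x y) = ccomp0 x * ccomp0 y - \sum_k cvec x k * (cvec y k)^*%C.
Proof.
rewrite sum_ord3 /cvec /=.
case: x y => [[? ? ? ?] [? ? ? ?]] [[? ? ? ?] [? ? ? ?]].
by apply/eqP; rewrite eq_complex /=; apply/andP; split; apply/eqP; ring.
Qed.

(** The product of C + C^3 with its SU(3)-symmetry in view: the vector part is a
conjugated cross product of the vector parts, up to the terms involving the
complex parts. *)
Lemma cvecM x y k : cvec (cmul x y) k =
  ccomp0 x * cvec y k + (ccomp0 y)^*%C * cvec x k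
  - (cvec x (k + 1) * cvec y (k + 2) - cvec x (k + 2) * cvec y (k + 1))^*%C.
Proof.
case: x y => [[? ? ? ?] [? ? ? ?]] [[? ? ? ?] [? ? ? ?]].
elim/ord3_ind: k; rewrite !ord3_add /cvec /=;
by apply/eqP; rewrite eq_complex /=; apply/andP; split; apply/eqP; ring.
Qed.

Lemma ccomp0_w x : ccomp0 (cw x) = ccomp0 x.
Proof. by rewrite cwE; case: x => [[? ? ? ?] [? ? ? ?]]. Qed.

Lemma cvec_w x k : cvec (cw x) k = omega1 R * cvec x k.
Proof.
rewrite cwE; case: x => [[? ? ? ?] [? ? ? ?]].
elim/ord3_ind: k; rewrite /cvec /=;
by apply/eqP; rewrite eq_complex /=; apply/andP; split; apply/eqP; ring.
Qed.

End Coordinates.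

(** * Coordinates on the Jordan algebra *)

Section JordanCoordinates.
Variable R : realType.
Local Notation M3 := 'M[R[i]]_3.
Implicit Types (X Y : jordan R) (A H M : M3).

Definition jpart X : M3 := map_mx (@ccomp0 R) X.

(** Conjugation negates the C^3-part, so the k-th components of the entries form
an antisymmetric matrix; row [k] is the corresponding vector. *)
Definition mpart X : M3 := \matrix_(k, l) cvec (X (l + 1) (l + 2)) k.

Lemma jordan_conj X i j : X j i = cconj (X i j).
Proof. by rewrite -{1}(jordanP X) cadjmxE. Qed.

Lemma jpart_herm X : adjmx (jpart X) = jpart X.
Proof.
by apply/matrixP=> i j; rewrite adjmxE !mxE (jordan_conj X j i) ccomp0_conj.
Qed.

Lemma cvec_jordanE X (l k : 'I_3) :
  ((cvec (X l l) k = 0) * (cvec (X (l + 1)%R (l + 2)%R) k = mpart X k l) *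
   (cvec (X l (l + 1)%R) k = mpart X k (l + 2)%R) *
   (cvec (X (l + 2)%R l) k = mpart X k (l + 1)%R) *
   (cvec (X (l + 2)%R (l + 1)%R) k = (- mpart X k l)%R) *
   (cvec (X (l + 1)%R l) k = (- mpart X k (l + 2))%R) *
   (cvec (X l (l + 2)%R) k = (- mpart X k (l + 1))%R))%type.
Proof.
have cN i j : cvec (X j i) k = - cvec (X i j) k.
  by rewrite jordan_conj cvec_conj.
split; last by rewrite cN !mxE !ord3_addA.
split; last by rewrite cN !mxE !ord3_addA.
split; last by rewrite cN !mxE.
do !split; try by rewrite !mxE ?ord3_addA.
have /eqP := cN l l.
by rewrite -addr_eq0 -mulr2n mulrn_eq0 /= => /eqP.
Qed.

Lemma jordan_ext X Y : jpart X = jpart Y -> mpart X = mpart Y -> X = Y.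
Proof.
move=> ej em; apply/val_inj/matrixP=> i j; apply: cayley_coord_ext => [|k].
  by have := congr1 (fun A : M3 => A i j) ej; rewrite !mxE.
have -> : j = i + (j - i) by rewrite addrC subrK.
elim/ord3_ind: (j - i); rewrite ?addr0 !cvec_jordanE //.
  by rewrite em.
by rewrite em.
Qed.

Lemma jpartD X Y : jpart (X + Y) = jpart X + jpart Y.
Proof. by apply/matrixP=> i j; rewrite !mxE ccomp0D. Qed.

Lemma mpartD X Y : mpart (X + Y) = mpart X + mpart Y.
Proof. by apply/matrixP=> i j; rewrite !mxE cvecD. Qed.

Lemma jpartZ r X : jpart (r *: X) = r%:C *: jpart X.
Proof. by apply/matrixP=> i j; rewrite !mxE ccomp0Z. Qed.

Lemma mpartZ r X : mpart (r *: X) = r%:C *: mpart X.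
Proof. by apply/matrixP=> i j; rewrite !mxE cvecZ. Qed.

Lemma jpart0 : jpart (0 : jordan R) = 0.
Proof. by rewrite -(scale0r 0) jpartZ !scale0r. Qed.

Lemma mpart0 : mpart (0 : jordan R) = 0.
Proof. by rewrite -(scale0r 0) mpartZ !scale0r. Qed.

Lemma jpart_w X : jpart (jordan_w X) = jpart X.
Proof. by apply/matrixP=> i j; rewrite !mxE ccomp0_w. Qed.

Lemma mpart_w X : mpart (jordan_w X) = omega1 R *: mpart X.
Proof. by apply/matrixP=> i j; rewrite !mxE cvec_w. Qed.

Lemma ccomp0_sum I (r : seq I) (P : pred I) (F : I -> cayley R) :
  ccomp0 (\sum_(i <- r | P i) F i) = \sum_(i <- r | P i) ccomp0 (F i).
Proof. exact: (big_morph _ (@ccomp0D R)). Qed.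

Lemma cvec_sum I (r : seq I) (P : pred I) (F : I -> cayley R) k :
  cvec (\sum_(i <- r | P i) F i) k = \sum_(i <- r | P i) cvec (F i) k.
Proof.
apply: (big_morph (fun x => cvec x k)) => [x y|]; first exact: cvecD.
by rewrite -(scale0r 0) cvecZ mul0r.
Qed.

(** The contribution of the C^3-parts is a sum of products of antisymmetric
matrices. The product of those of two vectors u and v is the rank one matrix of
v and u minus the scalar matrix u.v, whence [trdual]. *)
Lemma cmulmx_ccomp0 X Y i j : ccomp0 (cmulmx X Y i j) =
  (jpart X *m jpart Y + trdual (adjmx (mpart Y) *m mpart X)) i j.
Proof.
rewrite mxE ccomp0_sum [in RHS]mxE [in RHS]mxE.
under eq_bigr do rewrite ccomp0M.
rewrite sumrB; congr (_ + _); first by apply: eq_bigr => p _; rewrite !mxE.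
have -> : j = i + (j - i) by rewrite addrC subrK.
have delta d : (i == i + d) = (d == 0).
  by rewrite -[X in X == _]addr0 (inj_eq (addrI i)) eq_sym.
rewrite /trdual /mxtrace !mxE !(sum_ord3_rot _ i) !mxE !(sum_ord3_rot _ i).
rewrite !adjmxE delta.
elim/ord3_ind: (j - i); rewrite ?addr0 !cvec_jordanE ?conjc0 /=;
by move: (i + 1) (i + 2) (mpart X) (mpart Y) => ? ? ? ?; ring.
Qed.

Lemma jpartM X Y : jpart (jordan_mul X Y) = (2^-1)%:C *:
  (jpart X *m jpart Y + jpart Y *m jpart X
   + trdual (adjmx (mpart X) *m mpart Y + adjmx (mpart Y) *m mpart X)).
Proof.
rewrite jpartZ; congr (_ *: _); apply/matrixP=> i j.
have addE (A B : M3) : A i j + B i j = (A + B) i j by rewrite mxE.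
transitivity (ccomp0 (cmulmx X Y i j) + ccomp0 (cmulmx Y X i j)).
  by rewrite !mxE.
rewrite !cmulmx_ccomp0 addE addrACA -trdualD.
by rewrite [X in trdual X]addrC.
Qed.

(** At the position (l+1, l+2) the only products of two C^3-parts come from the
intermediate index [l], and they make up the minors of [cross]; the mixed
products make up the coefficients of [trdual]. *)
Lemma mpartM X Y : mpart (jordan_mul X Y) = (2^-1)%:C *:
  (mpart Y *m trdual (jpart X) + mpart X *m trdual (jpart Y)
   + ccross (mpart X) (mpart Y)).
Proof.
rewrite mpartZ; congr (_ *: _).
apply/matrixP=> k l; rewrite !mxE /= cvecD !cvec_sum !(sum_ord3_rot _ l).
rewrite !cvecM /trdual /mxtrace !(sum_ord3_rot _ l) !ord3_addA.
rewrite !cvec_jordanE -!ccomp0_conj -!jordan_conj.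
have [l1 l2] : (l + 1 == l) = false /\ (l + 2 == l) = false.
  by split; elim/ord3_ind: l.
rewrite !mxE !ord3_addA eqxx l1 l2 !mulr1n !mulr0n.
move: (l + 1) (l + 2) (k + 1) (k + 2) => ? ? ? ?; ring.
Qed.

End JordanCoordinates.

Section PartsConstructor.
Variable R : realType.
Local Notation M3 := 'M[R[i]]_3.
Implicit Types (A H M : M3) (X : jordan R).

Definition parts_mx A M : 'M[cayley R]_3 := \matrix_(i, j)
  let m k := if j == i + 1 then M k (i + 2)
             else if j == i + 2 then - M k (i + 1) else 0 in
  cayley_of_comp (A i j) (m 0) (m 1) (m 2).

(** The value is junk unless [A] is hermitian. The definition is locked to keep
unification from unfolding it down to Cayley numbers. *)
Fact of_parts_key : unit. Proof. by []. Qed.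
Definition of_parts : M3 -> M3 -> jordan R :=
  locked_with of_parts_key (fun A M => insubd (0 : jordan R) (parts_mx A M)).

Lemma ccomp0_of_comp (a m1 m2 m3 : R[i]) :
  ccomp0 (cayley_of_comp a m1 m2 m3) = a.
Proof. by rewrite cayley_of_compE; case: a. Qed.

Lemma cvec_of_comp (a : R[i]) (m : 'I_3 -> R[i]) k :
  cvec (cayley_of_comp a (m 0) (m 1) (m 2)) k = m k.
Proof.
rewrite cayley_of_compE; elim/ord3_ind: k;
 rewrite /cvec /= /ccomp1 /ccomp2 /ccomp3 /= ?opprK.
- by case: (m 0).
- by case: (m 1).
- by case: (m 2).
Qed.

Lemma parts_mx_herm A M : adjmx A = A -> cadjmx (parts_mx A M) == parts_mx A M.
Proof.
move=> hA; apply/eqP/matrixP=> i j; rewrite cadjmxE.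
apply: cayley_coord_ext => [|k].
  by rewrite ccomp0_conj !mxE !ccomp0_of_comp -[in RHS]hA adjmxE.
rewrite cvec_conj !mxE /=.
rewrite (cvec_of_comp _ (fun k => if i == j + 1 then M k (j + 2)
             else if i == j + 2 then - M k (j + 1) else 0)).
rewrite (cvec_of_comp _ (fun k => if j == i + 1 then M k (i + 2)
             else if j == i + 2 then - M k (i + 1) else 0)).
by elim/ord3_ind: i; elim/ord3_ind: j; rewrite !ord3_add /= ?oppr0 ?opprK.
Qed.

Lemma of_partsE A M : adjmx A = A -> of_parts A M = parts_mx A M :> 'M_3.
Proof.
move=> hA; rewrite /of_parts unlock; have := parts_mx_herm M hA.
by move=> h; rewrite -[LHS]/(val _) insubdK.
Qed.

Lemma jpart_of_parts A M : adjmx A = A -> jpart (of_parts A M) = A.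
Proof.
move=> hA; rewrite /jpart of_partsE //.
by apply/matrixP=> i j; rewrite !mxE ccomp0_of_comp.
Qed.

Lemma mpart_of_parts A M : adjmx A = A -> mpart (of_parts A M) = M.
Proof.
move=> hA; apply/matrixP=> k l; rewrite mxE of_partsE // mxE /=.
rewrite (cvec_of_comp _ (fun k => if l + 2 == l + 1 + 1 then M k (l + 1 + 2)
             else if l + 2 == l + 1 + 2 then - M k (l + 1 + 1) else 0)).
by rewrite !ord3_addA eqxx.
Qed.

End PartsConstructor.

(** * The action of SU(3) x SU(3) *)

Section Action.
Variable R : realType.
Local Notation M3 := 'M[R[i]]_3.
Implicit Types (P Q A B : SU3 R) (X Y : jordan R) (H K M N : M3).

Lemma adjmx_conj N H : adjmx H = H ->
  adjmx (N *m H *m adjmx N) = N *m H *m adjmx N.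
Proof. by move=> hH; rewrite !adjmxM adjmxK hH mulmxA. Qed.

Definition act_fun P A X : jordan R :=
  of_parts (A *m jpart X *m adjmx A) (P *m mpart X *m adjmx A).

Lemma jpart_act P A X : jpart (act_fun P A X) = A *m jpart X *m adjmx A.
Proof. by rewrite jpart_of_parts // adjmx_conj // jpart_herm. Qed.

Lemma mpart_act P A X : mpart (act_fun P A X) = P *m mpart X *m adjmx A.
Proof. by rewrite mpart_of_parts // adjmx_conj // jpart_herm. Qed.

Lemma act_funM P A Q B X :
  act_fun (P * Q)%g (A * B)%g X = act_fun P A (act_fun Q B X).
Proof.
apply: jordan_ext.
  by rewrite [LHS]jpart_act !jpart_act adjmxM !mulmxA.
by rewrite [LHS]mpart_act !mpart_act adjmxM !mulmxA.
Qed.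

Lemma act_fun1 : act_fun 1%g 1%g =1 id.
Proof.
move=> X; apply: jordan_ext.
  by rewrite jpart_act adjmx1 mulmx1 mul1mx.
by rewrite mpart_act adjmx1 mulmx1 mul1mx.
Qed.

Lemma SU3_conj_conjM A (N1 N2 H M : M3) :
  (N1 *m H *m adjmx A) *m (A *m M *m N2) = N1 *m (H *m M) *m N2.
Proof. by rewrite !mulmxA -(mulmxA _ (adjmx A)) (SU3P A).1 mulmx1. Qed.

(** The next two lemmas are the equivariance of the two components of the
product formula, isolated from the Jordan algebra. *)
Lemma herm_equivariant P A H K M N :
  A *m (H *m K + K *m H + trdual (adjmx M *m N + adjmx N *m M)) *m adjmx A =
  (A *m H *m adjmx A) *m (A *m K *m adjmx A)
  + (A *m K *m adjmx A) *m (A *m H *m adjmx A)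
  + trdual (adjmx (P *m M *m adjmx A) *m (P *m N *m adjmx A)
            + adjmx (P *m N *m adjmx A) *m (P *m M *m adjmx A)).
Proof.
have adjE M1 M2 : adjmx (P *m M1 *m adjmx A) *m (P *m M2 *m adjmx A) =
                  A *m (adjmx M1 *m M2) *m adjmx A.
  rewrite !adjmxM adjmxK !mulmxA -(mulmxA _ (adjmx P)).
  by rewrite (SU3P P).1 mulmx1.
by rewrite !SU3_conj_conjM !adjE !trdualD !trdual_conj !mulmxDr !mulmxDl.
Qed.

Lemma mx_equivariant P A H K M N :
  P *m (N *m trdual H + M *m trdual K + ccross M N) *m adjmx A =
  (P *m N *m adjmx A) *m trdual (A *m H *m adjmx A)
  + (P *m M *m adjmx A) *m trdual (A *m K *m adjmx A)
  + ccross (P *m M *m adjmx A) (P *m N *m adjmx A).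
Proof.
by rewrite !trdual_conj ccross_SU3 !SU3_conj_conjM !mulmxDr !mulmxDl.
Qed.

Lemma act_is_F4 P A : is_F4 (act_fun P A).
Proof.
split.
- move=> r X Y; apply: jordan_ext.
    rewrite jpart_act !jpartD !jpartZ !jpart_act.
    by rewrite mulmxDr mulmxDl -scalemxAr -scalemxAl.
  rewrite mpart_act !mpartD !mpartZ !mpart_act.
  by rewrite mulmxDr mulmxDl -scalemxAr -scalemxAl.
- exists (act_fun P^-1%g A^-1%g) => X;
    by rewrite -act_funM ?mulVg ?mulgV act_fun1.
- move=> X Y; apply: jordan_ext.
    rewrite [LHS]jpart_act [RHS]jpartM [in LHS]jpartM !jpart_act !mpart_act.
    by rewrite -scalemxAr -scalemxAl; congr (_ *: _); exact: herm_equivariant.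
  rewrite [LHS]mpart_act [RHS]mpartM [in LHS]mpartM !jpart_act !mpart_act.
  by rewrite -scalemxAr -scalemxAl; congr (_ *: _); exact: mx_equivariant.
Qed.

Definition act_F4 P A : F4 R := MkF4 (introT (asboolP _) (act_is_F4 P A)).

Lemma act_F4w_subproof P A : (w_F4 R * act_F4 P A == act_F4 P A * w_F4 R)%g.
Proof.
apply/eqP/F4_ext => X; apply: jordan_ext => /=.
  by rewrite jpart_w !jpart_act jpart_w.
by rewrite mpart_w !mpart_act mpart_w -scalemxAr -scalemxAl.
Qed.

Definition act P A : F4w R := MkF4w (act_F4w_subproof P A).

Lemma actM P A Q B : act (P * Q)%g (A * B)%g = (act P A * act Q B)%g.
Proof. by apply/val_inj/F4_ext => X; rewrite /= act_funM. Qed.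

End Action.

(** * The kernel of the action *)

Section Kernel.
Variable R : realType.
Local Notation M3 := 'M[R[i]]_3.
Implicit Types (P Q A B : SU3 R) (X Y : jordan R) (H K M N : M3).

Lemma omega1_neq1 : omega1 R != 1.
Proof.
apply/eqP => /(congr1 (@complex.Re R)) /= h.
have : (1 : R) + 1 / 2 = 0 by rewrite -{1}h; ring.
by apply/eqP; rewrite gt_eqF // addr_gt0 // divr_gt0.
Qed.

Lemma omega1_sum : 1 + omega1 R + omega1 R ^+ 2 = 0.
Proof.
have /eqP : (omega1 R - 1) * (1 + omega1 R + omega1 R ^+ 2) = 0.
  by rewrite -[RHS](subrr 1) -{3}(omega1_3 R); ring.
by rewrite mulf_eq0 subr_eq0 (negbTE omega1_neq1) => /eqP.
Qed.

Lemma cube_root_of_unity (a : R[i]) : a ^+ 3 = 1 -> exists n, a = omega1 R ^+ n.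
Proof.
move=> a3; have w2 : omega1 R ^+ 2 = - 1 - omega1 R.
  by rewrite -[RHS]add0r -omega1_sum; ring.
have /eqP : (a - 1) * ((a - omega1 R) * (a - omega1 R ^+ 2)) = 0.
  rewrite -[RHS](subrr 1) -{2}a3; ring: (omega1_3 R) w2.
rewrite !mulf_eq0 !subr_eq0 => /or3P[]/eqP->.
- by exists 0; rewrite expr0.
- by exists 1; rewrite expr1.
- by exists 2.
Qed.

(** The elements without [jpart] already detect the kernel: on them the action
is M |-> P M adj(A). *)
Lemma act_ker P A : act P A = 1%g -> Z3_pred (P, A).
Proof.
move=> e.
have eX X : act_fun P A X = X by rewrite -[act_fun _ _ X]/(act P A X) e.
have eM M : P *m M = M *m A.
  have := congr1 (@mpart R) (eX (of_parts 0 M)).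
  rewrite mpart_act mpart_of_parts ?adjmx0 //= => /(congr1 (mulmx^~ A)).
  by rewrite -mulmxA (SU3P A).1 mulmx1.
have PA : P = A by apply/val_inj; have := eM 1%:M; rewrite mulmx1 mul1mx.
subst P; have A_sc := commuting_scalar eM.
have [n an] : exists n, A 0 0 = omega1 R ^+ n.
  apply: cube_root_of_unity.
  by rewrite -det_scalar -A_sc (SU3P A).2.
apply/Z3_predP; exists n.
suff -> : A = (SU3_omega R ^+ n)%g by [].
apply/val_inj; rewrite /= A_sc an; elim: n {an} => [|n IHn].
  by rewrite expr0.
by rewrite exprS scalar_mxM IHn expgS.
Qed.

Lemma act_omega : act (SU3_omega R) (SU3_omega R) = 1%g.
Proof.
have conj_omega N : (omega1 R)%:M *m N *m adjmx (omega1 R)%:M = N.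
  by rewrite -scalar_mxC -mulmxA (SU3_mulV (SU3_omega R)) mulmx1.
apply/val_inj/F4_ext => X /=; apply: jordan_ext.
  by rewrite jpart_act conj_omega.
by rewrite mpart_act conj_omega.
Qed.

Lemma act_Z3 P A : Z3_pred (P, A) -> act P A = 1%g.
Proof.
case/Z3_predP=> n [-> ->]; elim: n => [|n IHn].
  by apply/val_inj/F4_ext => X; rewrite /= act_fun1.
by rewrite expgS actM act_omega IHn mul1g.
Qed.

End Kernel.

(** * The two components of an automorphism commuting with w *)

Section Components.
Variables (R : realType) (a : F4w R).
Local Notation M3 := 'M[R[i]]_3.
Implicit Types (X Y : jordan R) (H K M N Z : M3).

Lemma F4w_linear : linear a.
Proof. by case: (F4P a). Qed.

Lemma F4wD : {morph a : X Y / X + Y}.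
Proof. by move=> X Y; have := F4w_linear 1 X Y; rewrite !scale1r. Qed.

Lemma F4w0 : a 0 = 0.
Proof. by apply: (addIr (a 0)); rewrite -F4wD !add0r. Qed.

Lemma F4wZ r X : a (r *: X) = r *: a X.
Proof. by have := F4w_linear r X 0; rewrite F4w0 !addr0. Qed.

Lemma F4wM X Y : a (jordan_mul X Y) = jordan_mul (a X) (a Y).
Proof. by case: (F4P a). Qed.

Lemma F4w_comm X : a (jordan_w X) = jordan_w (a X).
Proof.
by case: a => f /= /eqP wf; have := congr1 (fun g : F4 R => g X) wf => /= ->.
Qed.

(** The elements without [mpart] are those fixed by w. *)
Lemma mpart_F4w X : mpart X = 0 -> mpart (a X) = 0.
Proof.
move=> X0; have wX : jordan_w X = X.
  by apply: jordan_ext; rewrite ?jpart_w // mpart_w X0 scaler0.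
have := congr1 (@mpart R) (F4w_comm X).
rewrite wX mpart_w => /esym/eqP.
rewrite -subr_eq0 -{2}[mpart _]scale1r -scalerBl.
by rewrite scaler_eq0 subr_eq0 (negbTE (omega1_neq1 R)) => /eqP.
Qed.

(** The elements without [jpart] are those killed by 1 + w + w^2. *)
Lemma jpart_F4w X : jpart X = 0 -> jpart (a X) = 0.
Proof.
move=> X0; have sumX : X + jordan_w X + jordan_w (jordan_w X) = 0.
  apply: jordan_ext.
    by rewrite !jpartD !jpart_w X0 !addr0 jpart0.
  rewrite !mpartD !mpart_w mpart0 scalerA -{1}[mpart X]scale1r -!scalerDl.
  by rewrite -expr2 omega1_sum scale0r.
have := congr1 (@jpart R \o a) sumX.
rewrite /= !F4wD !F4w_comm !jpartD !jpart_w F4w0 jpart0 -mulr2n -mulrSr.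
by rewrite -scaler_nat => /eqP; rewrite scaler_eq0 pnatr_eq0 => /eqP.
Qed.

Definition jmap H : M3 := jpart (a (of_parts H 0)).
Definition mmap M : M3 := mpart (a (of_parts 0 M)).

Lemma parts_split X : X = of_parts (jpart X) 0 + of_parts 0 (mpart X).
Proof.
apply: jordan_ext.
  by rewrite jpartD !jpart_of_parts ?jpart_herm ?adjmx0 ?addr0.
by rewrite mpartD !mpart_of_parts ?jpart_herm ?adjmx0 ?add0r.
Qed.

Lemma jmapE X : jpart (a X) = jmap (jpart X).
Proof.
rewrite {1}[X]parts_split F4wD jpartD (@jpart_F4w (of_parts 0 _)) ?addr0 //.
by rewrite jpart_of_parts // adjmx0.
Qed.

Lemma mmapE X : mpart (a X) = mmap (mpart X).
Proof.
rewrite {1}[X]parts_split F4wD mpartD (@mpart_F4w (of_parts _ 0)) ?add0r //.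
by rewrite mpart_of_parts // jpart_herm.
Qed.

Lemma jmap_herm H : adjmx (jmap H) = jmap H.
Proof. exact: jpart_herm. Qed.

Lemma mmap_surj N : exists M, mmap M = N.
Proof.
have [_ [b _ bK] _] := F4P a.
by exists (mpart (b (of_parts 0 N))); rewrite -mmapE bK mpart_of_parts ?adjmx0.
Qed.

(** Commuting with w makes [mmap] commute with omega1, which generates C over
R. *)
Lemma mmap_linear : linear mmap.
Proof.
have mmapD M N : mmap (M + N) = mmap M + mmap N.
  rewrite -[M in LHS](mpart_of_parts M (adjmx0 R)).
  rewrite -[N in LHS](mpart_of_parts N (adjmx0 R)).
  by rewrite -mpartD -mmapE F4wD mpartD.
have mmapZ r M : mmap (r%:C *: M) = r%:C *: mmap M.
  rewrite -[M in LHS](mpart_of_parts M (adjmx0 R)) -mpartZ -mmapE.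
  by rewrite F4wZ mpartZ.
have mmapW M : mmap (omega1 R *: M) = omega1 R *: mmap M.
  rewrite -[M in LHS](mpart_of_parts M (adjmx0 R)) -mpart_w -mmapE F4w_comm.
  by rewrite mpart_w.
move=> c M N; rewrite mmapD; congr (_ + _).
have [u [v ->]] : exists u v : R, c = u%:C + v%:C * omega1 R.
  have s3 : Num.sqrt 3 != 0 :> R by rewrite sqrtr_eq0 -ltNge ltr0n.
  case: c => p q; exists (p + q / Num.sqrt 3), (2 * q / Num.sqrt 3).
  by apply/eqP; rewrite eq_complex /=; apply/andP; split; apply/eqP; field.
by rewrite !scalerDl -!scalerA mmapD !mmapZ mmapW.
Qed.

Lemma mmap0 : mmap 0 = 0.
Proof.
by have := mmap_linear (-1) 0 0; rewrite scaler0 scaleN1r !addNr addr0.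
Qed.

Lemma mmapZ c M : mmap (c *: M) = c *: mmap M.
Proof. by rewrite -[c *: M]addr0 mmap_linear mmap0 addr0. Qed.

Lemma jmap0 : jmap 0 = 0.
Proof. by have := jmapE 0; rewrite F4w0 jpart0. Qed.

(** The product of (H, 0) by (0, M). *)
Lemma mmap_trdual H M : adjmx H = H ->
  mmap (M *m trdual H) = mmap M *m trdual (jmap H).
Proof.
move=> hH; have := congr1 (@mpart R) (F4wM (of_parts H 0) (of_parts 0 M)).
rewrite mmapE !mpartM !jmapE !mmapE.
rewrite !jpart_of_parts ?adjmx0 // !mpart_of_parts ?adjmx0 //.
rewrite mmap0 jmap0 !ccross0 trdual0 !mul0mx !addr0 mmapZ.
by move/(scalerI (half_neq0 R)).
Qed.

(** The hermitian component of the square of (0, M). *)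
Lemma jmap_sq M :
  jmap (trdual (adjmx M *m M)) = trdual (adjmx (mmap M) *m mmap M).
Proof.
have half N : (2^-1)%:C *: (trdual (N + N) : M3) = trdual N.
  by rewrite -trdualZ -mulr2n half_double.
have := congr1 (@jpart R) (F4wM (of_parts 0 M) (of_parts 0 M)).
rewrite jmapE !jpartM !jmapE !mmapE.
rewrite !jpart_of_parts ?adjmx0 // !mpart_of_parts ?adjmx0 //.
by rewrite jmap0 !mul0mx !add0r !half.
Qed.

(** The other component of the square of (0, M). *)
Lemma mmap_comatrix M :
  mmap (map_mx conjc (comatrix M)) = map_mx conjc (comatrix (mmap M)).
Proof.
have half N : (2^-1)%:C *: ccross N N = map_mx conjc (comatrix N).
  by rewrite /ccross crossMM raddfMn /= half_double.
have := congr1 (@mpart R) (F4wM (of_parts 0 M) (of_parts 0 M)).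
rewrite mmapE !mpartM !jmapE !mmapE.
rewrite !jpart_of_parts ?adjmx0 // !mpart_of_parts ?adjmx0 //.
rewrite jmap0 trdual0 !mulmx0 !add0r.
by rewrite (half M) (half (mmap M)).
Qed.

End Components.

(** * Surjectivity of the action *)

Section Surjectivity.
Variables (R : realType) (a : F4w R).
Local Notation M3 := 'M[R[i]]_3.
Implicit Types (X Y : jordan R) (H K M N Z : M3).

Let U : M3 := mmap a 1%:M.
(** Right multiplication by [Z], transported by [mmap]: see [mmap_mulr]. *)
Let twist Z : M3 := adjmx U *m mmap a Z.

(** Pick M0 with beta(M0) = 1. Evaluating beta(M0 D(D(1))) with
gamma(D(1)) = D(adj(U) U) yields D(D(1)) = D(D(adj(U) U)). *)
Lemma mmap1_unitary : adjmx U *m U = 1%:M.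
Proof.
apply/esym/trdual_inj/trdual_inj.
have := jmap_sq a 1%:M; rewrite adjmx1 mul1mx => U1.
have [M0 M01] := mmap_surj a 1%:M.
have := mmap_trdual a M0 (_ : adjmx (trdual 1%:M) = trdual 1%:M).
rewrite trdual_adj adjmx1 U1 M01 mul1mx => /(_ erefl) <-.
have [c ->] : exists c, trdual (trdual 1%:M) = c%:M :> M3.
  by exists (\tr (1%:M : M3) + 1); rewrite trdual_twice raddfD.
by rewrite mul_mx_scalar mmapZ M01 scalemx1.
Qed.

(** [mmap_comatrix] at 1 says that the comatrix of the unitary matrix [U] is its
conjugate, as it is in determinant 1. *)
Lemma mmap1_det : \det U = 1.
Proof.
have UE : map_mx conjc (comatrix U) = U.
  by rewrite -mmap_comatrix comatrix1 map_mx1.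
have := comatrix_det U; rewrite (_ : (comatrix U)^T = adjmx U).
  rewrite mmap1_unitary => /(congr1 (fun M : M3 => M 0 0)).
  by rewrite !mxE eqxx !mulr1n => <-.
by rewrite -[in RHS]UE; apply/matrixP=> i j; rewrite adjmxE !mxE conjcK.
Qed.

Lemma mmap1_SU3 : (adjmx U *m U == 1%:M) && (\det U == 1).
Proof. by rewrite mmap1_unitary mmap1_det !eqxx. Qed.

Lemma mmap1_twist Z : mmap a Z = U *m twist Z.
Proof. by rewrite /twist mulmxA (mulmx1C mmap1_unitary) mul1mx. Qed.

Lemma twist_trdual H : adjmx H = H -> twist (trdual H) = trdual (jmap a H).
Proof.
move=> hH; rewrite /twist -[trdual H]mul1mx mmap_trdual // mulmxA.
by rewrite mmap1_unitary mul1mx.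
Qed.

Lemma twist_linear : linear twist.
Proof. by move=> c M N; rewrite /twist mmap_linear mulmxDr -scalemxAr. Qed.

Lemma twist_herm K : adjmx K = K ->
  adjmx (twist K) = twist K /\ forall M, mmap a (M *m K) = mmap a M *m twist K.
Proof.
(* every hermitian matrix is [trdual] of a hermitian matrix *)
move=> hK; have [H hH <-] : exists2 H, adjmx H = H & trdual H = K.
  exists (2^-1 *: (trdual K - K)); last exact: trdualK.
  rewrite adjmxZ conjc_inv conjc_nat -scaleN1r adjmxD adjmxZ rmorphN1.
  by rewrite trdual_adj hK.
rewrite twist_trdual //; split; first by rewrite trdual_adj jmap_herm.
by move=> M; rewrite mmap_trdual.
Qed.

Lemma twistD M N : twist (M + N) = twist M + twist N.
Proof. by have := twist_linear 1 M N; rewrite !scale1r. Qed.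

Lemma twistZ c M : twist (c *: M) = c *: twist M.
Proof. by rewrite /twist mmapZ -scalemxAr. Qed.

Lemma mmap_mulr M Z : mmap a (M *m Z) = mmap a M *m twist Z.
Proof.
have [H [K [hH hK ->]]] := herm_decomp Z.
have [_ HE] := twist_herm hH; have [_ KE] := twist_herm hK.
rewrite twistD twistZ !mulmxDr -!scalemxAr addrC mmap_linear HE KE.
by rewrite addrC.
Qed.

Lemma twist_adj Z : adjmx (twist Z) = twist (adjmx Z).
Proof.
have [H [K [hH hK ->]]] := herm_decomp Z.
have [HE _] := twist_herm hH; have [KE _] := twist_herm hK.
by rewrite !(twistD, adjmxD) !(twistZ, adjmxZ) hH hK HE KE.
Qed.

Lemma twistM : {morph twist : Z W / Z *m W}.
Proof. by move=> Z W; rewrite {1}/twist mmap_mulr mulmxA. Qed.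

(** For an intertwiner [B], the compatibility of [twist] with adjoints makes
adj(B) B commute with all matrices, hence [B] a similitude. *)
Lemma twist_inner : exists A : SU3 R, forall Z, twist Z = A *m Z *m adjmx A.
Proof.
have [B nzB GB] := skolem_noether_intertwiner twist_linear twistM mmap1_unitary.
have BG Z : adjmx B *m twist Z = Z *m adjmx B.
  have := congr1 (@adjmx R) (GB (adjmx Z)).
  by rewrite (adjmxM (twist _) B) (adjmxM B) twist_adj !adjmxK.
have BB : adjmx B *m B = ((adjmx B *m B) 0 0)%:M.
  by apply: commuting_scalar => Z; rewrite -mulmxA -GB mulmxA BG mulmxA.
have [s [A AE]] := similitude_SU3 nzB BB.
exists A => Z; have : twist Z *m A = A *m Z.
  by rewrite -AE -scalemxAr -scalemxAl GB.
by move=> <-; rewrite -mulmxA SU3_mulV mulmx1.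
Qed.

Lemma act_surj : exists P A, act P A = a.
Proof.
have [A GA] := twist_inner.
exists (MkSU3 mmap1_SU3 * A)%g, A; apply/val_inj/F4_ext => X.
apply: jordan_ext; rewrite /=.
  rewrite jpart_act jmapE; apply: trdual_inj.
  by rewrite trdual_conj -GA twist_trdual ?jpart_herm.
by rewrite mpart_act mmapE mmap1_twist GA !mulmxA.
Qed.

End Surjectivity.

Lemma act_eq_coset (R : realType) (p q : SU3 R * SU3 R) :
  act p.1 p.2 = act q.1 q.2 <->
  \pi_(quot_group (Z3 R))%qT p = \pi_(quot_group (Z3 R))%qT q.
Proof.
have actV P A : act P^-1%g A^-1%g = (act P A)^-1%g :> F4w R.
  apply: (mulgI (act P A)); rewrite -actM !mulgV.
  by apply/val_inj/F4_ext => X; rewrite /= act_fun1.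
split=> [epq|/quot_eqP/act_Z3 epq].
  by apply/quot_eqP/act_ker; rewrite actM actV epq mulVg.
by apply: (mulgI (act p.1 p.2)^-1%g); rewrite mulVg -actV -actM.
Qed.

Theorem theorem2p12p2 (R : realType) :
  exists phi : {multiplicative F4w R -> quot_group (Z3 R)}, bijective phi.
Proof.
pose G := (SU3 R * SU3 R)%type.
have [pre preK] :
    exists pre : F4w R -> G, forall a, act (pre a).1 (pre a).2 = a.
  have ex a : exists p : G, act p.1 p.2 = a.
    by have [P [A PA]] := act_surj a; exists (P, A).
  by have [pre preK] := boolp.choice ex; exists pre.
pose phi a := \pi_(quot_group (Z3 R))%qT (pre a).
have phi_act (p : G) : phi (act p.1 p.2) = \pi_(quot_group (Z3 R))%qT p.
  by apply/act_eq_coset; rewrite preK.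
have phiM : {morph phi : a b / (a * b)%g}.
  move=> a b; rewrite {2 3}/phi [RHS]quot_mulE -phi_act.
  by rewrite actM !preK.
pose phi_mul := isMultiplicative.Build _ _ phi phiM.
exists (HB.pack_for {multiplicative F4w R -> quot_group (Z3 R)} phi phi_mul).
exists (fun c => act (repr c).1 (repr c).2) => [a|c] /=.
  by rewrite -[RHS]preK; apply/act_eq_coset; rewrite reprK.
by rewrite phi_act reprK.
Qed.
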